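(* A finite generalized dihedral $2$-group $H$ satisfies $\alpha(H)=\frac{3}{4}$ if and only if there is $n\in\mathbb{N}$ such that $H\cong\mathbb{Z}_2^n\times D_{16}$.
   Context: For a finite group $G$, $L_1(G)$ denotes the set (poset) of cyclic subgroups of $G$ (including the trivial subgroup), and $\alpha(G)=\frac{|L_1(G)|}{|G|}$. For an abelian group $G$, the generalized dihedral group associated to $G$ is the semidirect product $D(G)=G\rtimes\mathbb{Z}_2$, where the generator $y$ of $\mathbb{Z}_2$ acts on $G$ by inversion $g\mapsto g^{-1}$; equivalently $D(G)=\langle G,y\mid y^2=1,\ ygy=g^{-1}\ \forall\, g\in G\rangle$. A finite generalized dihedral $2$-group is a finite $2$-group of the form $D(G)$ with $G$ abelian. $D_{16}$ is the dihedral group of order $16$, $\mathbb{Z}_m$ is the cyclic group of order $m$, and $\mathbb{N}$ includes $0$. *)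

(* Defs.v *)
From mathcomp Require Import all_boot all_order all_algebra all_fingroup all_solvable.

Set Implicit Arguments.
Unset Strict Implicit.
Unset Printing Implicit Defensive.

Import GroupScope GRing.Theory.

Definition cyclic_subgroups (gT : finGroupType) (G : {group gT}) :
  {set {group gT}} := [set C in subgroups G | cyclic C].

Definition alpha (gT : finGroupType) (G : {group gT}) : rat :=
  (#|cyclic_subgroups G|%:R / #|G|%:R)%R.

(* H is generalized dihedral if it is the (internal) semidirect product of an
   abelian group G and a group <[y]> of order 2, with y acting on G by
   inversion.  The case of G elementary abelian, where this action is trivial,
   is included. *)
Definition generalized_dihedral (gT : finGroupType) (H : {group gT}) : Prop :=
  exists (G : {group gT}) (y : gT),
    [/\ abelian G, #[y] = 2%N, G ><| <[y]> = H
      & {in G, forall g : gT, g ^ y = g^-1}].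

(* The group law inherited by row vectors is addition. *)
Definition Z2_pow (n : nat) : {group 'rV['Z_2]_n} := [set: 'rV['Z_2]_n]%G.

(* Main.v *)
Require Import Defs.
From mathcomp Require Import all_boot all_order all_algebra all_fingroup all_solvable.
From mathcomp Require Import ring zify.

Import GroupScope GRing.Theory Num.Theory.

Set Implicit Arguments.
Unset Strict Implicit.
Unset Printing Implicit Defensive.

(** A cyclic group of order m has totient m generators, so the number of cyclic
    subgroups of G is the sum over x in G of 1 / totient #[x]
    ([card_cyclic_subgroups_sum]).  Everything is read off this weighted count.

    When H is generalized dihedral over G, the elements of H outside G are
    involutions, each of weight 1, whence alpha H = (1 + alpha G) / 2
    ([alpha_gen_dihedral]).  Thus alpha H = 3/4 means that alpha G = 1/2.

    Let G be an abelian 2-group, E the subgroup of elements of order at most 2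
    and F that of elements of order at most 4.  The weight is 1 on E, 1/2 on
    F \ E and at most 1/4 outside F, so that
      4 |L_1(G)| <= |G| + |F| + 2 |E|     ([card_cyclic_subgroups_le]).
    If F = G, all weights are at least 1/2 and that of the identity is 1, so
    alpha G > 1/2.  Otherwise G has an element x of order 8; the inclusions
    E < F < G are strict, 2 |F| <= |G| and 2 |E| <= |F|, and alpha G = 1/2 forces
    |G| = 4 |E|.  A complement A of <[x ^+ 4]> in E then satisfies
    A \x <[x]> = G for reasons of order ([abelian_alpha_half]).  The inverting
    involution y centralises the elementary abelian group A, and H is the direct
    product of A and the subgroup generated by x and y, a copy of 'D_16.

    Conversely, a factor of exponent 2 changes no weight in a 2-group, hence
    does not change alpha ([alpha_setX_abelem]), and 'D_16 is dihedral over
    a cyclic group of order 8, which has 4 subgroups. *)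

(** * Counting cyclic subgroups by their generators *)

Lemma card_cyclic_subgroups_sum (gT : finGroupType) (G : {group gT}) :
  (#|cyclic_subgroups G|%:R = \sum_(x in G) (totient #[x])%:R^-1 :> rat)%R.
Proof.
rewrite (partition_big (fun x => <[x]>%G) (mem (cyclic_subgroups G))) /=; last first.
  by move=> x Gx; rewrite !inE cycle_subG Gx cycle_cyclic.
rewrite -sum1_card natr_sum; apply: eq_bigr => C.
rewrite !inE => /andP[sCG /cyclicP[z defC]].
have genE x : (x \in G) && (<[x]>%G == C) = (x \in [set t | generator <[z]> t]).
  rewrite inE /generator -defC eq_sym -val_eqE /=; apply: andb_idl => /eqP defx.
  by rewrite -cycle_subG -defx.
under eq_bigl do rewrite genE.
rewrite (eq_bigr (fun=> ((totient #|C|)%:R^-1)%R)) => [|x]; last first.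
  by rewrite inE /generator -defC orderE => /eqP <-.
rewrite sumr_const -totient_gen orderE -defC.
rewrite -[RHS]mulr_natr mulVf // pnatr_eq0 -lt0n totient_gt0.
exact: cardG_gt0.
Qed.

Lemma alpha_isog (aT rT : finGroupType) (G : {group aT}) (K : {group rT}) :
  G \isog K -> alpha G = alpha K.
Proof.
move=> isoGK; rewrite /alpha -(card_isog isoGK) !card_cyclic_subgroups_sum.
case/isogP: isoGK => f injf <-; congr (_ / _)%R.
rewrite morphimEdom big_imset /=; last exact/injmP.
by apply: eq_bigr => x Gx; rewrite order_injm.
Qed.

(** A subgroup of a cyclic group is determined by its order, which can be any
    divisor of the order of the group. *)
Lemma card_cyclic_subgroups_cycle (gT : finGroupType) (x : gT) :
  #|cyclic_subgroups <[x]>| = size (divisors #[x]).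
Proof.
rewrite cardE -(size_map (fun C : {group gT} => #|C|)); apply: perm_size.
apply: uniq_perm; rewrite ?divisors_uniq //.
  rewrite map_inj_in_uniq ?enum_uniq // => C D.
  rewrite !mem_enum !inE => /andP[sC _] /andP[sD _] eqCD.
  apply: val_inj; apply/eqP.
  by rewrite (eq_subG_cyclic (cycle_cyclic x)) // eqCD.
move=> d; rewrite -dvdn_divisors //; apply/mapP/idP => [[C]|dvd_d].
  by rewrite mem_enum !inE => /andP[sC _] ->; apply: cardSg.
exists <[x ^+ (#[x] %/ d)]>%G.
  by rewrite mem_enum !inE cycle_subG mem_cycle cycle_cyclic.
by rewrite /= -orderE orderXdiv ?dvdn_div // divnA // mulKn.
Qed.

(** * Direct factors of exponent two *)

Lemma sum_setX (R : nmodType) (T1 T2 : finType) (A : {set T1}) (B : {set T2})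
    (F : T1 * T2 -> R) :
  (\sum_(u in setX A B) F u = \sum_(a in A) \sum_(b in B) F (a, b))%R.
Proof.
by rewrite pair_big_dep /=; apply: eq_big => [[a b]|[a b]] //; exact: in_setX.
Qed.

(** If d <> 1, its order is even and is also the order of (a, d).  If d = 1, the
    two orders may differ, but they are both at most 2, and totients do not tell
    1 from 2. *)
Lemma totient_order_pair (aT gT : finGroupType) (a : aT) (d : gT) :
  a ^+ 2 = 1 -> 2.-elt d -> totient #[(a, d)] = totient #[d].
Proof.
have expE k : (a, d) ^+ k = (a ^+ k, d ^+ k).
  by elim: k => // k IHk; rewrite !expgS IHk.
move=> a2 /p_natP[[|k] od].
  move/eqP: od; rewrite order_eq1 => /eqP d1; rewrite {d expE}d1 in expE *.
  have: #[(a, 1 : gT)] %| 2 by rewrite order_dvdn expE a2 expg1n.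
  by rewrite dvdn_divisors // !inE order1 => /orP[] /eqP->.
suff ->: #[(a, d)] = #[d] by [].
apply/eqP; rewrite eqn_dvd !order_dvdn expE expg_order andbC.
have:= expg_order (a, d); rewrite expE => -[_ ->]; rewrite eqxx /=.
by rewrite od expnS expgM a2 expg1n.
Qed.

Lemma alpha_setX_abelem (aT gT : finGroupType) (A : {group aT}) (K : {group gT}) :
  2.-abelem A -> 2.-group K -> alpha (setX A K) = alpha K.
Proof.
move=> /abelemP[] // _ A2 K2.
rewrite /alpha cardsX !card_cyclic_subgroups_sum sum_setX /=.
rewrite (eq_bigr (fun=> \sum_(x in K) (totient #[x])%:R^-1))%R => [|a Aa]; last first.
  by apply: eq_bigr => d Kd; rewrite totient_order_pair ?A2 //; exact: mem_p_elt Kd.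
rewrite sumr_const -[(_ *+ #|A|)%R]mulr_natl natrM -mulf_div divff ?mul1r //.
by rewrite pnatr_eq0 -lt0n cardG_gt0.
Qed.

(** * Generalized dihedral groups *)

(** Outside G, an element g * y has square g * g ^ y = 1 and weight 1; there are
    #|G| such elements in a group of order 2 * #|G|. *)
Lemma alpha_gen_dihedral (gT : finGroupType) (G H : {group gT}) (y : gT) :
    #[y] = 2%N -> G ><| <[y]> = H -> {in G, forall g, g ^ y = g^-1} ->
  alpha H = ((1 + alpha G) / 2%:R)%R.
Proof.
move=> oy defH invG; have [_ /mulG_sub[sGH _] _ _] := sdprodP defH.
have cardH: #|H| = (#|G| * 2)%N by rewrite -(sdprod_card defH) -orderE oy.
have y2: y * y = 1 by rewrite -(expg_order y) oy.
have outside: {in H :\: G, forall h, #[h] = 2}.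
  move=> h /setDP[Hh notGh]; apply: nt_prime_order => //; last first.
    by apply: contraNneq notGh => ->.
  case/sdprodP: defH Hh => _ <- _ _ /mulsgP[g z Gg].
  rewrite (cycle2g oy) !inE => /orP[] /eqP-> eh.
    by case/negP: notGh; rewrite eh mulg1.
  have yV: y^-1 = y by apply/eqP; rewrite eq_invg_mul y2.
  have yg: y * (g * y) = g^-1 by rewrite -invG // conjgE yV.
  by rewrite eh expgS expg1 -mulgA yg mulgV.
rewrite /alpha cardH !card_cyclic_subgroups_sum (big_setID G) /= (setIidPr sGH).
rewrite (eq_bigr (fun=> 1%R) (P := fun x => x \in H :\: G)) => [|h]; last first.
  by move/outside->; rewrite invr1.
have ->: (\sum_(h in H :\: G) 1 = #|G|%:R :> rat)%R.
  by rewrite sumr_const cardsD (setIidPr sGH) cardH muln2 -addnn addnK.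
have nz: (#|G|%:R != 0 :> rat)%R by rewrite pnatr_eq0 -lt0n cardG_gt0.
by rewrite natrM; field.
Qed.

Lemma alpha_dihedral16 : alpha [set: 'D_16]%G = (3%:R / 4%:R)%R.
Proof.
have [[x y] gens [oy xy]] :=
  @generators_2dihedral _ [set: 'D_16]%G 4 isT (isog_refl _).
have [[defD _ invX] _ _ _ _] := dihedral2_structure (n := 4) isT gens (isog_refl _).
have [_ _ ox /setDP[_ notXy]] := gens.
rewrite (alpha_gen_dihedral (G := <[x]>%G) oy defD).
  by rewrite /alpha card_cyclic_subgroups_cycle -orderE ox; vm_compute.
by move=> g Xg; apply: invX; rewrite ?inE ?notXy.
Qed.

(** The relations make D a quotient of 'D_q.*2, and the orders agree. *)
Lemma dihedral_isog (gT : finGroupType) (D : {group gT}) (x y : gT) (q : nat) :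
    1 < q -> #[x] = q -> #[y] = 2 -> x ^ y = x^-1 -> <[x]> <*> <[y]> = D ->
  #|D| = q.*2 -> D \isog 'D_q.*2.
Proof.
move=> q_gt1 ox oy xy defD oD.
have homD: D \homg 'D_q.*2.
  rewrite (Grp_dihedral q_gt1) //; apply/existsP; exists (x, y).
  by rewrite /= !xpair_eqE /= defD -{1}ox -{1}oy !expg_order xy !eqxx.
have [f injf <-]: exists2 f : {morphism [set: 'D_q.*2] >-> gT},
    'injm f & f @* [set: 'D_q.*2] = D.
  case/homgP: homD => f imf; exists f => //.
  by rewrite -card_im_injm imf oD (card_dihedral q_gt1).
by rewrite isog_sym sub_isog.
Qed.

(** * Abelian 2-groups with half as many cyclic subgroups as elements *)

Lemma card_Ldiv_sum (gT : finGroupType) (G : {group gT}) n :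
  #|'Ldiv_n(G)| = (\sum_(x in G) (x ^+ n == 1)%g)%N.
Proof.
rewrite -sum1_card big_mkcond [RHS]big_mkcond; apply: eq_bigr => x _.
by rewrite !inE; case: (x \in G).
Qed.

(** The bound is attained exactly for the orders 1, 2, 4 and 8. *)
Lemma inv_totient_le (gT : finGroupType) (x : gT) : 2.-elt x ->
  (4%:R * (totient #[x])%:R^-1
     <= (1 + (x ^+ 4 == 1)%g + 2 * (x ^+ 2 == 1)%g)%N%:R :> rat)%R.
Proof.
rewrite ler_pdivrMr ?ltr0n ?totient_gt0 ?order_gt0 //.
rewrite -natrM ler_nat -!order_dvdn.
case/p_natP=> -[|[|[|k]]] ->; [by []|by []|by []|].
rewrite totient_pfactor // mul1n (leq_trans _ (leq_pmull _ _)) //.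
by rewrite (leq_pexp2l (m := 2) (n1 := 2)).
Qed.

Lemma card_cyclic_subgroups_le (gT : finGroupType) (G : {group gT}) : 2.-group G ->
  4 * #|cyclic_subgroups G| <= #|G| + #|'Ldiv_4(G)| + 2 * #|'Ldiv_2(G)|.
Proof.
move=> G2; rewrite -(ler_nat rat) natrM card_cyclic_subgroups_sum !card_Ldiv_sum.
rewrite -sum1_card mulr_sumr (big_distrr 2) -!big_split natr_sum /=.
by apply: ler_sum => x Gx; apply: inv_totient_le; apply: mem_p_elt Gx.
Qed.

(** All weights are at least 1/2; the inequality is strict because the identity
    has weight 1. *)
Lemma card_cyclic_subgroups_exponent4 (gT : finGroupType) (G : {group gT}) :
  {in G, forall x, x ^+ 4 = 1} -> #|G| < 2 * #|cyclic_subgroups G|.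
Proof.
move=> G4; rewrite -(ltr_nat rat) natrM card_cyclic_subgroups_sum.
rewrite -sum1_card natr_sum mulr_sumr (bigD1 1) // [X in (_ < X)%R](bigD1 1) //=.
rewrite order1 mulr1; apply: ltr_leD => //.
apply: ler_sum => x /andP[Gx _].
have: #[x] %| 4 by rewrite order_dvdn G4.
rewrite ler_pdivlMr ?ltr0n ?totient_gt0 ?order_gt0 // mul1r ler_nat.
by rewrite dvdn_divisors // !inE => /or3P[] /eqP->.
Qed.

Lemma proper_double_card (gT : finGroupType) (A B : {group gT}) :
  A \proper B -> 2 * #|A| <= #|B|.
Proof.
move=> /properP[sAB [x Bx notAx]].
rewrite -(Lagrange sAB) mulnC leq_mul2l indexg_gt1.
by apply/orP; right; apply: contra notAx => /subsetP; apply.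
Qed.

Lemma abelian_alpha_half (gT : finGroupType) (G : {group gT}) :
    abelian G -> 2.-group G -> alpha G = (1 / 2%:R)%R ->
  exists (A : {group gT}) (x : gT), [/\ 2.-abelem A, #[x] = 8 & A \x <[x]> = G].
Proof.
move=> cGG G2 alphaG.
have cardL: (2 * #|cyclic_subgroups G| = #|G|)%N.
  have nz: (#|G|%:R != 0 :> rat)%R by rewrite pnatr_eq0 -lt0n cardG_gt0.
  apply/eqP; rewrite -(eqr_nat rat) natrM; apply/eqP.
  move: alphaG; rewrite /alpha => /(congr1 (fun q => q * #|G|%:R * 2%:R)%R).
  by rewrite divfK // mulrC => ->; field.
have OhmE n: 'Ohm_n(G) = 'Ldiv_(2 ^ n)(G).
  by apply: (OhmEabelian G2); apply: abelianS cGG; apply: Ohm_sub.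
have [x Gx ox]: exists2 x, x \in G & #[x] = 8.
  have [z Gz z4]: exists2 z, z \in G & z ^+ 4 != 1.
    apply/exists_inP; apply/contraT; rewrite negb_exists_in => /forall_inP G4.
    have/card_cyclic_subgroups_exponent4: {in G, forall x, x ^+ 4 = 1}.
      by move=> x /G4; rewrite negbK => /eqP.
    by rewrite cardL ltnn.
  have /p_natP[k oz] := mem_p_elt G2 Gz.
  have k3: 3 <= k.
    rewrite ltnNge; apply: contra z4 => k2.
    by rewrite -order_dvdn oz (dvdn_exp2l 2 (n := 2)).
  exists (z ^+ (2 ^ (k - 3))); first exact: groupX.
  by rewrite orderXdiv oz ?dvdn_exp2l ?leq_subr // -expnB ?leq_subr // subKn.
have x4: x ^+ 4 != 1 by rewrite -order_dvdn ox.
have EF: 'Ohm_1(G) \proper 'Ohm_2(G).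
  apply/properP; split; first exact: Ohm_leq.
  exists (x ^+ 2); rewrite !OhmE !inE groupX -?expgM //=.
  by rewrite -(expg_order x) ox.
have FG: 'Ohm_2(G) \proper G.
  apply/properP; split; first exact: Ohm_sub.
  by exists x; rewrite // OhmE !inE Gx.
have leEF := proper_double_card EF; have leFG := proper_double_card FG.
have leL := card_cyclic_subgroups_le G2.
rewrite -(OhmE 1%N) -(OhmE 2) /= in leL leEF leFG.
have cardG: #|G| = (4 * #|'Ohm_1(G)|)%N.
  move: #|G| #|'Ohm_1(G)| #|'Ohm_2(G)| #|cyclic_subgroups G| cardL leL leEF leFG.
  by move=> g e f l; lia.
have abelE: 2.-abelem 'Ohm_1(G) by apply: Ohm1_abelem.
have sZE: <[x ^+ 4]> \subset 'Ohm_1(G).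
  by rewrite cycle_subG /= OhmE !inE groupX // -expgM -order_dvdn ox.
have oZ: #|<[x ^+ 4]>| = 2 by rewrite -orderE orderXdiv ox.
have [A /complP[tiZA defE]] := splitsP (abelem_splits abelE sZE).
have sAE: A \subset 'Ohm_1(G) by rewrite -defE mulG_subr.
have sAG := subset_trans sAE (Ohm_sub 1%N G).
have sxG: <[x]> \subset G by rewrite cycle_subG.
have cardE: #|'Ohm_1(G)| = (2 * #|A|)%N by rewrite -defE TI_cardMg // oZ.
have abelA := abelemS sAE abelE.
(* A nontrivial element of A in <[x]> would be the only involution x ^+ 4 of
   <[x]>, whereas A avoids <[x ^+ 4]>. *)
have tiAx: A :&: <[x]> = 1.
  apply/trivgP/subsetP => a /setIP[Aa xa]; apply/contraT; rewrite inE => nta.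
  have oa: #[a] = 2 by apply: nt_prime_order => //; case/abelemP: abelA => // _ ->.
  have/eqP eqa: <[a]> == <[x ^+ 4]>.
    rewrite (eq_subG_cyclic (cycle_cyclic x)) ?cycle_subG ?mem_cycle //.
    by rewrite oZ -orderE oa.
  have: a \in <[x ^+ 4]> :&: A by rewrite inE Aa -eqa cycle_id.
  by rewrite tiZA inE (negPf nta).
exists A, x; split=> //; rewrite dprodE //; last by rewrite (sub_abelian_cent2 cGG).
apply/eqP; rewrite eqEcard mul_subG // TI_cardMg // -orderE ox.
by rewrite cardG cardE mulnA mulnC leqnn.
Qed.

(** * The classification *)

(** 'Z_2 and 'F_2 are convertible, so that Z2_pow n is a vector space over a
    prime field. *)
Lemma Z2_pow_abelem n : 2.-abelem (Z2_pow n).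
Proof. exact: (@fin_Fp_lmod_abelem 2 'rV['F_2]_n). Qed.

Lemma abelem_isog_Z2_pow (gT : finGroupType) (A : {group gT}) :
  2.-abelem A -> exists n, A \isog Z2_pow n.
Proof.
move=> abelA; have /p_natP[n cardA] := abelem_pgroup abelA.
exists n; rewrite (isog_abelem_card _ abelA) Z2_pow_abelem /= cardsT card_mx card_ord.
by rewrite mul1n cardA.
Qed.

Unset Implicit Arguments.

Theorem theorem3p6 (gT : finGroupType) (H : {group gT})
  (H2 : 2.-group H) (Hdih : generalized_dihedral H) :
  alpha H = (3%:R / 4%:R)%R <->
  exists n : nat, H \isog setX (Z2_pow n) 'D_16.
Proof.
split=> [alphaH|[n isoH]]; last first.
  rewrite (alpha_isog isoH) (alpha_setX_abelem (K := [set: 'D_16]%G)).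
  - exact: alpha_dihedral16.
  - exact: Z2_pow_abelem.
  by rewrite /pgroup (card_dihedral (q := 8)).
have [G [y [cGG oy defH invG]]] := Hdih.
have [_ mulGy _ _] := sdprodP defH.
have [sGH _] := mulG_sub mulGy.
have alphaG: alpha G = (1 / 2%:R)%R.
  apply: (addrI 1%R); apply: (@mulIf _ (2%:R)^-1%R) => //.
  by rewrite -(alpha_gen_dihedral oy defH invG) alphaH.
have [A [x [abelA ox defG]]] := abelian_alpha_half cGG (pgroupS sGH H2) alphaG.
have [_ mulAx cAx _] := dprodP defG; have [sAG sxG] := mulG_sub mulAx.
have Gx: x \in G by rewrite -cycle_subG.
have nxy: <[y]> \subset 'N(<[x]>).
  by rewrite cycle_subG; apply/normP; rewrite -cycleJ invG // cycleV.
have cardH: #|H| = (#|A| * 16)%N.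
  by rewrite -(sdprod_card defH) -(dprod_card defG) -!orderE ox oy -mulnA.
pose D := (<[x]> <*> <[y]>)%G.
have defD: <[x]> * <[y]> = D by rewrite -norm_joinEr.
have cardD: #|D| = 16.
  rewrite -defD TI_cardMg -?orderE ?ox ?oy //; apply/trivgP.
  by case/sdprodP: defH => _ _ _ <-; apply: setSI.
have mulAD: A * D = H by rewrite -defD mulgA mulAx.
have defAD: A \x D = H.
  rewrite dprodE //; last by apply: cardMg_TI; rewrite mulAD cardH cardD.
  rewrite join_subG cAx cycle_subG; apply/centP => a Aa.
  (* y inverts a, and a is its own inverse. *)
  apply: commute_sym; apply/commgP/conjg_fixP.
  rewrite invG ?(subsetP sAG) //; apply/eqP; rewrite eq_invg_mul.
  by case/abelemP: abelA => // _ /(_ a Aa) <-.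
have [n isoA] := abelem_isog_Z2_pow abelA.
exists n; apply: (isog_dprod defAD (setX_dprod (Z2_pow n) [set: 'D_16]%G)).
  exact: (isog_trans isoA (isog_setX1 _ _)).
apply: isog_trans (isog_set1X _ _).
exact: (dihedral_isog (q := 8) isT ox oy (invG x Gx) erefl cardD).
Qed.
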